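(* Let $n>m\ge 2$ be integers. Let $C_r\subset J_n(m,m-1)$ be a clique of size $r\ge 2$ and let $H$ be a maximal clique in $J_n(m,m-1)$ with $C_r\subset H$. Then: (1) if $H\in\mathcal{M}_{min}$, then $\left|\bigcup_{v\in V(C_r)}\nu(v)\right| = m+1$ and $\left|\bigcap_{v\in V(C_r)}\nu(v)\right| = m+1-r$; (2) if $H\in\mathcal{M}_{max}$, then $\left|\bigcup_{v\in V(C_r)}\nu(v)\right| = m-1+r$ and $\left|\bigcap_{v\in V(C_r)}\nu(v)\right| = m-1$.
   Context: $[n]=\{1,2,\ldots,n\}$ and $\binom{[n]}{m}$ is the collection of all $m$-element subsets of $[n]$. The Johnson graph $J_n(m,m-1)$ is the simple undirected graph with $\binom{n}{m}$ nodes, each node $v$ labelled by a unique set $\nu(v)\in\binom{[n]}{m}$ (so $\nu$ is a bijection from nodes to $\binom{[n]}{m}$), in which distinct nodes $v_i,v_j$ are adjacent if and only if $|\nu(v_i)\cap\nu(v_j)| = m-1$. A clique is a complete subgraph (identified with its vertex set); its size is its number of vertices; a clique is maximal if no strictly larger clique contains it. The inclusion $C_r\subset H$ is not required to be strict. $\mathcal{M}_{min}$ denotes the set of maximal cliques $H$ of $J_n(m,m-1)$ whose intersection set $\bigcap_{v\in V(H)}\nu(v)$ is empty, and $\mathcal{M}_{max}$ denotes the set of maximal cliques $H$ of $J_n(m,m-1)$ whose intersection set $\bigcap_{v\in V(H)}\nu(v)$ has size $m-1$. *)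

(* Defs.v *)
From mathcomp Require Import all_boot all_order all_algebra.

Set Implicit Arguments.
Unset Strict Implicit.
Unset Printing Implicit Defensive.

(* The ground set [n] = {1, ..., n} is represented by 'I_n = {0, ..., n - 1}. *)
Definition msubset (n m : nat) := {A : {set 'I_n} | #|A| == m}.

Section Cliques.
Variables (V : finType) (e : rel V).

Definition clique (K : {set V}) : bool :=
  [forall u in K, forall v in K, (u != v) ==> e u v].

Definition maximal_clique (H : {set V}) : bool := maxset clique H.

End Cliques.

Section Johnson.
Variables (n m : nat) (V : finType) (nu : V -> msubset n m).

(* Adjacency in J_n(m, m-1), for a node type V labelled by nu; nu is assumed  *)
(* bijective where the graph is used.                                         *)
Definition johnson : rel V :=
  [rel u v | (u != v) && (#|val (nu u) :&: val (nu v)| == m - 1)].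

Definition label_cup (K : {set V}) : {set 'I_n} := \bigcup_(v in K) val (nu v).
Definition label_cap (K : {set V}) : {set 'I_n} := \bigcap_(v in K) val (nu v).

Definition Mmin : {set {set V}} :=
  [set H | maximal_clique johnson H & label_cap H == set0].

Definition Mmax : {set {set V}} :=
  [set H | maximal_clique johnson H & #|label_cap H| == m - 1].

End Johnson.

(* Main.v *)
Require Import Defs.
From mathcomp Require Import all_boot all_order all_algebra.
From mathcomp Require Import zify.

Set Implicit Arguments.
Unset Strict Implicit.
Unset Printing Implicit Defensive.

(** Any two vertices of a clique of [J_n(m, m-1)] carry [m]-sets [A] and [B]
    with [#|A :&: B| = m - 1] and [#|A :|: B| = m + 1].  A third vertex either
    lies below [A :|: B] or above [A :&: B], and the whole clique follows the
    same alternative ([clique_cup_or_cap]).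

    If [H] has empty intersection set, the second alternative is excluded since
    [m - 1 > 0].  So the labels of [H], hence those of [Cr], are the complements
    of single points in one set [U] of size [m + 1]; for [Cr] these points are
    [r] in number, and removing them from [U] leaves the intersection, while any
    two of the labels already cover [U].

    If [H] has an intersection set [D] of size [m - 1], every label of [Cr] is
    [D] plus one point.  These [r] points are distinct and form, with [D], the
    union, while any two of the labels already meet exactly in [D].

    In both cases the count is that of a union of distinct singletons
    ([card_bigcup_singletons]). *)

Lemma card_bigcup_singletons (I T : finType) (K : {set I}) (F : I -> {set T}) :
    {in K &, injective F} -> {in K, forall i, #|F i| = 1} ->
  #|\bigcup_(i in K) F i| = #|K|.
Proof.
move=> injF F1; rewrite -cover_imset.
have /eqP <- : trivIset (F @: K).
  apply/trivIsetP => _ _ /imsetP[i iK ->] /imsetP[j jK ->].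
  have /eqP/cards1P[x ->] := F1 i iK.
  have /eqP/cards1P[y ->] := F1 j jK.
  by move=> xy; rewrite disjoints1 inE; apply: contraNneq xy => ->.
by rewrite big_imset //= (eq_bigr (fun=> 1)) ?sum1_card.
Qed.

(** The set [W] meets [A] in [k] points; a point of [W] outside [A :|: B]
    leaves at most [k] points of [W] inside, so [W] has the same trace on
    [A], on [B] and on [A :|: B].  That trace is then [A :&: B]. *)
Lemma setI_setU_eq (T : finType) (A B W : {set T}) k :
    #|A :&: B| = k -> #|W :&: A| = k -> #|W :&: B| = k -> #|W| = k.+1 ->
    ~~ (W \subset A :|: B) ->
  W :&: (A :|: B) = A :&: B.
Proof.
move=> AB WA WB Wk WU.
have lek : #|W :&: (A :|: B)| <= k.
  have := cardsID (A :|: B) W; rewrite Wk.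
  have : 0 < #|W :\: (A :|: B)| by rewrite card_gt0 setD_eq0.
  by lia.
have eqA : W :&: A = W :&: (A :|: B).
  by apply/eqP; rewrite eqEcard setIS ?subsetUl //= WA.
have eqB : W :&: B = W :&: (A :|: B).
  by apply/eqP; rewrite eqEcard setIS ?subsetUr //= WB.
have sub : W :&: (A :|: B) \subset A :&: B.
  by rewrite subsetI -{1}eqA -eqB !subsetIr.
by apply/eqP; rewrite eqEcard sub AB -eqA WA leqnn.
Qed.

Section JohnsonCliques.
Variables (n m : nat) (V : finType) (nu : V -> msubset n m).
Implicit Types (u v w : V) (K : {set V}).

Lemma card_label v : #|val (nu v)| = m.
Proof. by apply/eqP; exact: valP (nu v). Qed.

Lemma clique_cardI K u v : clique (johnson nu) K ->
  u \in K -> v \in K -> u != v -> #|val (nu u) :&: val (nu v)| = m - 1.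
Proof.
move=> /forall_inP cK uK vK uv.
by have /forall_inP/(_ v vK)/implyP/(_ uv)/andP[_ /eqP] := cK u uK.
Qed.

Lemma clique_cardU K u v : 0 < m -> clique (johnson nu) K ->
  u \in K -> v \in K -> u != v -> #|val (nu u) :|: val (nu v)| = m + 1.
Proof.
move=> m0 cK uK vK uv.
by rewrite cardsU !card_label (clique_cardI cK) //; lia.
Qed.

(** A vertex [w] escaping [A :|: B] forces every label to contain [A :&: B]:
    the labels below [A :|: B] can meet that of [w] only inside [A :&: B],
    which has just the required number of points. *)
Lemma clique_cup_or_cap K u v : 0 < m -> clique (johnson nu) K ->
    u \in K -> v \in K -> u != v ->
  {in K, forall w, val (nu w) \subset val (nu u) :|: val (nu v)} \/
  {in K, forall w, val (nu u) :&: val (nu v) \subset val (nu w)}.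
Proof.
move=> m0 cK uK vK uv.
set A := val (nu u); set B := val (nu v).
have AB : #|A :&: B| = m - 1 := clique_cardI cK uK vK uv.
have trace w : w \in K -> ~~ (val (nu w) \subset A :|: B) ->
    val (nu w) :&: (A :|: B) = A :&: B.
  move=> wK wU.
  have wu : w != u by apply: contraNneq wU => ->; exact: subsetUl.
  have wv : w != v by apply: contraNneq wU => ->; exact: subsetUr.
  apply: setI_setU_eq AB (clique_cardI cK wK uK wu)
                         (clique_cardI cK wK vK wv) _ wU.
  by rewrite card_label; lia.
have [/forall_inP cup|] :=
    boolP [forall w in K, val (nu w) \subset A :|: B].
  by left.
rewrite negb_forall_in => /exists_inP[w wK wU]; right=> x xK.
have [xU|xU] := boolP (val (nu x) \subset A :|: B); last first.
  by rewrite -(trace x xK xU) subsetIl.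
have wx : w != x by apply: contraNneq wU => ->.
have sub : val (nu w) :&: val (nu x) \subset A :&: B.
  by rewrite -(trace w wK wU) setIS.
have /eqP <- : val (nu w) :&: val (nu x) == A :&: B.
  by rewrite eqEcard sub AB (clique_cardI cK wK xK wx) leqnn.
exact: subsetIr.
Qed.

Hypothesis nu_inj : injective nu.

Lemma label_inj : injective (fun v => val (nu v)).
Proof. by move=> u v /val_inj/nu_inj. Qed.

(** Taking complements in [U] turns the intersection into a union of
    singletons. *)
Lemma card_label_cap_below K (U : {set 'I_n}) : 0 < #|K| -> #|U| = m + 1 ->
    {in K, forall v, val (nu v) \subset U} ->
  #|label_cap nu K| + #|K| = m + 1.
Proof.
move=> /card_gt0P[u uK] cU sU.
have compl v : v \in K -> U :\: (U :\: val (nu v)) = val (nu v).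
  by move=> vK; rewrite setDDr setDv set0U (setIidPr (sU v vK)).
have capU : label_cap nu K \subset U by rewrite (bigcap_min u) ?sU.
have <- : #|U :\: label_cap nu K| = #|K|.
  have -> : U :\: label_cap nu K = \bigcup_(v in K) (U :\: val (nu v)).
    rewrite setDE setC_bigcap big_distrr /=.
    by apply: eq_bigr => v _; rewrite setDE.
  apply: card_bigcup_singletons => [v w vK wK eqD|v vK].
    by apply: label_inj; rewrite /= -(compl v vK) -(compl w wK) eqD.
  by rewrite cardsDS ?sU // cU card_label; lia.
by rewrite cardsDS // subnKC ?subset_leq_card.
Qed.

Lemma card_label_cup_above K (D : {set 'I_n}) : 0 < m -> 0 < #|K| ->
    #|D| = m - 1 -> {in K, forall v, D \subset val (nu v)} ->
  #|label_cup nu K| = m - 1 + #|K|.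
Proof.
move=> m0 /card_gt0P[u uK] cD sD.
have Dcup : D \subset label_cup nu K by rewrite (bigcup_max u) ?sD.
have <- : #|label_cup nu K :\: D| = #|K|.
  have -> : label_cup nu K :\: D = \bigcup_(v in K) (val (nu v) :\: D).
    by rewrite setDE big_distrl /=; apply: eq_bigr => v _; rewrite setDE.
  apply: card_bigcup_singletons => [v w vK wK eqD|v vK].
    apply: label_inj => /=.
    by rewrite -(setID (val (nu v)) D) -(setID (val (nu w)) D) eqD
       (setIidPr (sD v vK)) (setIidPr (sD w wK)).
  by rewrite cardsDS ?sD // cD card_label; lia.
by rewrite -cD cardsDS // subnKC ?subset_leq_card.
Qed.

End JohnsonCliques.

Theorem proposition4p2 (n m : nat) (hm : 2 <= m) (hnm : m < n)
    (V : finType) (nu : V -> msubset n m) (hnu : bijective nu)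
    (r : nat) (hr : 2 <= r)
    (Cr : {set V}) (hC : clique (johnson nu) Cr) (hCr : #|Cr| = r)
    (H : {set V}) (hH : maximal_clique (johnson nu) H) (hsub : Cr \subset H) :
  (H \in Mmin nu ->
     #|label_cup nu Cr| = m + 1 /\
     (#|label_cap nu Cr|%:Z = m%:Z + 1 - r%:Z)%R) /\
  (H \in Mmax nu ->
     #|label_cup nu Cr| = m - 1 + r /\
     #|label_cap nu Cr| = m - 1).
Proof.
have m0 : 0 < m by lia.
have Cr0 : 0 < #|Cr| by lia.
have nu_inj := bij_inj hnu.
have cH : clique (johnson nu) H by case/maxsetP: hH.
have /card_gt1P[u [v [uC vC uv]]] : 1 < #|Cr| by rewrite hCr.
have [uH vH] := (subsetP hsub u uC, subsetP hsub v vC).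
have cardU := clique_cardU m0 hC uC vC uv.
have cardI := clique_cardI hC uC vC uv.
split; rewrite inE => /andP[_ /eqP capH].
- have [below|above] := clique_cup_or_cap m0 cH uH vH uv; last first.
    have : val (nu u) :&: val (nu v) \subset label_cap nu H by apply/bigcapsP.
    by rewrite capH subset0 => /eqP AB0; move: cardI; rewrite AB0 cards0; lia.
  have belowC : {in Cr, forall w, val (nu w) \subset val (nu u) :|: val (nu v)}.
    by move=> w wC; apply/below/(subsetP hsub).
  split.
    suff -> : label_cup nu Cr = val (nu u) :|: val (nu v) by [].
    apply/eqP; rewrite eqEsubset; apply/andP; split; first exact/bigcupsP.
    by rewrite subUset (bigcup_sup u) ?(bigcup_sup v).
  by have := card_label_cap_below nu_inj Cr0 cardU belowC; lia.
- have aboveC : {in Cr, forall w, label_cap nu H \subset val (nu w)}.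
    by move=> w wC; exact: bigcap_inf (subsetP hsub w wC).
  split; first by rewrite -hCr; apply: card_label_cup_above aboveC.
  apply/eqP; rewrite eqn_leq -{1}cardI -capH; apply/andP; split.
    by apply: subset_leq_card; rewrite subsetI !bigcap_inf.
  by apply: subset_leq_card; apply/bigcapsP.
Qed.
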